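(* Let $n\in\{2,3\}$. For every $\mathbf{v}=[v_1,\dots,v_n]$ with $v_i\in\mathbb{Z}^n$ primitive and $\|\mathbf{v}\|=|\det(v_1,\dots,v_n)|>1$, and every top-dimensional cone $\sigma$ of the Voronoi fan $\mathscr{V}$ containing $b(\mathbf{v})=\sum_{i=1}^n v_iv_i^t$, one has $\operatorname{Cand}\mathbf{v}\cap\operatorname{Vertex}\sigma\neq\varnothing$.
   Context: A vector of $\mathbb{Z}^n$ is primitive if the gcd of its coordinates is $1$; let $\mathscr{P}$ be the set of primitive vectors. $\operatorname{Cand}\mathbf{v}=\{w\in\mathbb{Z}^n: w\ne0,\ w=\sum q_iv_i,\ q_i\in\mathbb{Q},\ 0\le|q_i|<1\}$. Let $V$ be the real vector space of symmetric $n\times n$ matrices (dimension $n(n+1)/2$). For $v\in\mathscr{P}$ put $q(v)=vv^t$. The Voronoi polyhedron $\Pi$ is the closed convex hull in $V$ of $\{q(v):v\in\mathscr{P}\}$; the cones (with apex $0$) over the faces of $\Pi$ form a fan $\mathscr{V}$; a cone is top-dimensional if it has dimension $n(n+1)/2$. For $\sigma\in\mathscr{V}$, $\operatorname{Vertex}\sigma$ is the set of $v\in\mathscr{P}$ such that $q(v)$ is a vertex of the face of $\Pi$ generating $\sigma$. *)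

(* Defs.v *)
From HB Require Import structures.
From mathcomp Require Import all_boot all_order all_algebra.
From mathcomp Require Import all_classical all_reals all_analysis.
Import Order.TTheory GRing.Theory Num.Theory numFieldNormedType.Exports.

Set Implicit Arguments.
Unset Strict Implicit.
Unset Printing Implicit Defensive.

Local Open Scope classical_set_scope.
Local Open Scope ring_scope.

Definition primitive n (v : 'cV[int]_n) : Prop :=
  \big[gcdn/0%N]_(i < n) `|v i ord0|%N = 1%N.

Definition det_cols n (v : 'I_n -> 'cV[int]_n) : int :=
  \det (\matrix_(i < n, j < n) v j i 0).

Definition Cand n (v : 'I_n -> 'cV[int]_n) : set 'cV[int]_n :=
  [set w | w != 0 /\
    exists q : 'I_n -> rat,
      (forall i, 0 <= `|q i| < 1) /\
      map_mx intr w = \sum_i q i *: map_mx intr (v i)].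

Section Voronoi.
Variables (R : realType) (n : nat).

Definition qform (v : 'cV[int]_n) : 'M[R]_n :=
  map_mx intr v *m (map_mx intr v)^T.

Definition bform (v : 'I_n -> 'cV[int]_n) : 'M[R]_n := \sum_i qform (v i).

Definition closed_convex_hull (X : set 'M[R]_n) : set 'M[R]_n :=
  smallest [set A : set 'M[R]_n | closed A /\ convex_set (M := 'M[R]_n) A] X.

(* The space [V] of symmetric matrices is closed in ['M[R]_n], so that the
   closed convex hull of a subset of [V] is the same in both spaces. *)
Definition voronoi_polyhedron : set 'M[R]_n :=
  closed_convex_hull [set qform v | v in [set v | primitive v]].

(* [F] is cut out of [K] by the hyperplane [phi = c] of [V], where [K] lies
   in the half-space [c <= phi].  As a linear form on ['M[R]_n] may vanish
   on [V], [phi] is required not to, so that [phi = c] really defines a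
   hyperplane of [V]; in particular, a [K] that affinely spans [V] is not a
   face of itself.  The empty set may be a face. *)
Definition is_face (K F : set 'M[R]_n) : Prop :=
  exists (phi : {linear 'M[R]_n -> R^o}) (c : R),
    [/\ exists2 x : 'M[R]_n, x^T = x & phi x != 0,
        forall x, K x -> c <= phi x
      & F = K `&` [set x | phi x = c]].

Definition is_vertex (K : set 'M[R]_n) (x : 'M[R]_n) : Prop :=
  is_face K [set x].

(* [0] is added for the cone over the empty face. *)
Definition cone_over (F : set 'M[R]_n) : set 'M[R]_n :=
  [set 0] `|` [set x | exists t y, [/\ 0 <= t, F y & x = t *: y]].

Definition voronoi_fan : set (set 'M[R]_n) :=
  [set cone_over F | F in is_face voronoi_polyhedron].

(* The dimension of a cone with apex [0] is that of its linear span. *)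
Definition has_dim (sigma : set 'M[R]_n) (d : nat) : Prop :=
  exists U : {vspace 'M[R]_n},
    [/\ forall x, sigma x -> x \in U,
        forall W : {vspace 'M[R]_n},
          (forall x, sigma x -> x \in W) -> (U <= W)%VS
      & \dim U = d].

Definition top_dimensional (sigma : set 'M[R]_n) : Prop :=
  has_dim sigma (n * n.+1)./2.

Definition Vertex (sigma : set 'M[R]_n) : set 'cV[int]_n :=
  [set v | primitive v /\
    exists F, [/\ is_face voronoi_polyhedron F, sigma = cone_over F
                & is_vertex F (qform v)]].

End Voronoi.

Arguments voronoi_polyhedron : clear implicits.
Arguments voronoi_fan : clear implicits.

(* Main.v *)
(** Let [phi = c] be the supporting hyperplane of the face generating [sigma].
    Top-dimensionality and the shape of the polyhedron force [c > 0], so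
    [phi (q w) >= c] for every nonzero integral [w], and each primitive [w]
    with [phi (q w) = c] is in [Vertex sigma].  Suppose that no such [w] is in
    [Cand v], and let [T x] be the trace of the quadratic form [x] in the basis
    [v].  A primitive [w] with [T (q w) < 1] is in [Cand v], and there are
    finitely many of these, so [T + K (phi - c) >= 1] on the polyhedron for
    some [K >= 0].  Write [b(v) = t y] with [y] in the face.  As [T (b(v)) = n],
    this yields [t <= n], while
    [t c = phi (b(v)) = phi (q v_1) + ... + phi (q v_n) >= n c]; hence
    [phi (q v_i) = c] for all [i].  Rounding a point outside of the lattice
    spanned by the [v_i] coordinate by coordinate then gives a nonzero integral
    [w] with [phi (q w) <= n c / 4 < c], a contradiction. *)
From HB Require Import structures.
Require Import Defs.
From mathcomp Require Import all_boot all_order all_algebra.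
From mathcomp Require Import all_classical all_reals all_analysis.
From mathcomp Require Import ring lra zify.
Import Order.TTheory GRing.Theory Num.Theory numFieldNormedType.Exports.

Set Implicit Arguments.
Unset Strict Implicit.
Unset Printing Implicit Defensive.

Local Open Scope classical_set_scope.
Local Open Scope ring_scope.

(** * Linear forms on the Voronoi polyhedron *)

Section LinearForms.
Variables (R : realType) (n : nat).
Implicit Types (phi : {linear 'M[R]_n -> R^o}) (z w : 'cV[R]_n).

Lemma linear_form_continuous phi : continuous phi.
Proof.
have -> : (phi : 'M[R]_n -> R^o) =
    \sum_i \sum_j (fun x : 'M[R]_n => x i j * phi (delta_mx i j) : R^o).
  apply/funext => x; rewrite {1}(matrix_sum_delta x) linear_sum fct_sumE.
  apply: eq_bigr => i _; rewrite fct_sumE linear_sum.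
  by apply: eq_bigr => j _; rewrite linearZ.
have sum_cont (I : finType) (F : I -> 'M[R]_n -> R^o) :
    (forall i, continuous (F i)) -> continuous (\sum_i F i).
  move=> cF; apply: (big_ind (fun f : 'M[R]_n -> R^o => continuous f)) => //.
  - by move=> x; exact: (@cst_continuous _ R^o 0).
  - by move=> f g cf cg x; apply: continuousD; [exact: cf|exact: cg].
apply: (sum_cont) => i; apply: (sum_cont) => j x.
apply: (@continuousM R _ (fun y : 'M[R]_n => y i j) (cst _) x).
  exact: coord_continuous.
exact: (@cst_continuous _ R^o).
Qed.

(** The half-space [c <= phi] is closed and convex, so it contains the hull as soon as it contains
    the generators. *)
Lemma linear_form_ge_polyhedron phi (c : R) :
    (forall u, primitive u -> c <= phi (qform R u)) ->
  forall x, voronoi_polyhedron R n x -> c <= phi x.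
Proof.
move=> phi_ge; apply: smallest_sub => [|_ [u pu <-]]; last exact: phi_ge.
split.
  apply: (@preimage_closed _ _ phi [set r : R^o | c <= r]) (@closed_ge _ c).
  by move=> x _; exact: linear_form_continuous.
apply/convex_setW => x y /set_mem /= cx /set_mem /= cy k k0 k1.
apply/mem_set => /=.
rewrite /conv /= linearD !linearZ /=.
have /= := lerD (ler_wpM2l (ltW k0) cx) (ler_wpM2l (_ : 0 <= 1 - k%:num) cy).
rewrite subr_ge0 => /(_ (ltW k1)); rewrite -mulrDl addrC subrK mul1r.
exact.
Qed.

Definition trace_form (C x : 'M[R]_n) : R^o := \tr (C *m x).

Lemma trace_form_is_linear C : linear (trace_form C).
Proof. by move=> a x y; rewrite /trace_form mulmxDr -scalemxAr linearP. Qed.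

HB.instance Definition _ C := GRing.isLinear.Build R 'M[R]_n R^o _
  (trace_form C) (trace_form_is_linear C).

Lemma trace_form_gram p (N : 'M[R]_(p, n)) z :
  trace_form (N^T *m N) (z *m z^T) = \sum_i (N *m z) i 0 ^+ 2.
Proof.
rewrite /trace_form -mulmxA mxtrace_mulC mulmxA -[X in \tr X]mulmxA -trmx_mul.
by apply: eq_bigr => i _; rewrite [LHS]mxE big_ord1 [_^T _ _]mxE expr2.
Qed.

Lemma linear_form_rank1D phi z w (s : R) :
  phi ((z + s *: w) *m (z + s *: w)^T) =
  phi (z *m z^T) + s * phi (z *m w^T + w *m z^T) + s ^+ 2 * phi (w *m w^T).
Proof.
rewrite linearD /= linearZ /= mulmxDr !mulmxDl -!scalemxAl -!scalemxAr scalerA.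
rewrite !linearD !linearZ /= /GRing.scale /= expr2; ring.
Qed.

Lemma polyhedron_qform (u : 'cV[int]_n) :
  primitive u -> voronoi_polyhedron R n (qform R u).
Proof.
by move=> pu; apply: (@sub_smallest _ _ _ _ (@subset_refl _ _)); exists u.
Qed.

(** The form x_ba - x_ab vanishes on the generators, hence is nonnegative on the hull; exchanging a
    and b gives equality. *)
Lemma polyhedron_sym (x : 'M[R]_n) : voronoi_polyhedron R n x -> x^T = x.
Proof.
move=> Px; apply/matrixP => i j; rewrite mxE.
have le a b : x a b <= x b a.
  have := @linear_form_ge_polyhedron
    (trace_form (delta_mx a b - delta_mx b a)) 0 _ _ Px.
  have tr_delta k l (y : 'M[R]_n) : \tr (delta_mx k l *m y) = y l k.
    rewrite -(mul_delta_mx (0 : 'I_1)) -mulmxA mxtrace_mulC -rowE -colE.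
    by rewrite /mxtrace big_ord1 !mxE.
  rewrite /= /trace_form mulmxBl linearB /= !tr_delta subr_ge0; apply => u _.
  rewrite /= /trace_form mulmxBl linearB /= !tr_delta !mxE !big_ord1 !mxE.
  by rewrite mulrC subrr.
by apply/le_anti; rewrite !le.
Qed.

Lemma polyhedron_gram_ge0 p (N : 'M[R]_(p, n)) (x : 'M[R]_n) :
  voronoi_polyhedron R n x -> 0 <= trace_form (N^T *m N) x.
Proof.
apply: linear_form_ge_polyhedron => u _; rewrite [leRHS]trace_form_gram.
by apply: sumr_ge0 => i _; rewrite sqr_ge0.
Qed.

End LinearForms.

(** * Primitive integral vectors *)

Lemma primitive_neq0 n (u : 'cV[int]_n) : primitive u -> u != 0.
Proof.
move=> pu; apply/eqP => u0; move: pu; rewrite /primitive u0.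
by rewrite big1 // => i _; rewrite mxE.
Qed.

Lemma ord_neq n (i : 'I_n) : (1 < n)%N -> exists j : 'I_n, j != i.
Proof.
move=> n1; have [->|] := eqVneq i (Ordinal n1).
  by exists (Ordinal (ltnW n1)).
by exists (Ordinal n1); rewrite eq_sym.
Qed.

Lemma colN0P (T : nmodType) n (u : 'cV[T]_n) : u != 0 -> exists i, u i 0 != 0.
Proof.
move=> u0; apply/existsP; rewrite -[X in is_true X]negbK negb_exists.
apply: contra u0 => /forallP u0; apply/eqP/colP => i.
by rewrite mxE; apply/eqP; have := u0 i; rewrite negbK.
Qed.

(* If g divides all entries and a = m u_i, then g divides a^2 and a u_j + 1,
   hence 1. *)
Lemma primitive_shift n (u : 'cV[int]_n) (i j : 'I_n) (m : int) :
  j != i -> primitive ((m * u i 0) *: u + delta_mx j 0).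
Proof.
move=> ji; rewrite /primitive; set g := \big[_/_]_(_ < _) _.
have gP k : (g%:Z %| ((m * u i 0) * u k 0 + (k == j)%:R)%R)%Z.
  by apply: (biggcdn_inf k); rewrite // !mxE eqxx andbT.
have := gP i; rewrite eq_sym (negPf ji) addr0 => /(dvdz_mull (m * u j 0 ^+ 2)).
have := gP j; rewrite eqxx => /(dvdz_mull (1 - m * u i 0 * u j 0)) => h1 h2.
have := rpredD h1 h2.
rewrite [X in (_ %| X)%Z](_ : _ = 1); last by rewrite /=; ring.
by rewrite dvdz1 => /eqP.
Qed.

Lemma primitive_part n (u : 'cV[int]_n) : u != 0 ->
  exists (g : nat) (u' : 'cV[int]_n),
    [/\ (0 < g)%N, primitive u' & u = g%:Z *: u'].
Proof.
move=> u0; set g := \big[gcdn/0%N]_(i < n) `|u i ord0|%N.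
have gP k : (g%:Z %| u k ord0)%Z by apply: (biggcdn_inf k).
have g0 : (0 < g)%N.
  have [i ui] := colN0P u0; rewrite lt0n; apply: contraNneq ui => g0.
  by have := gP i; rewrite g0 dvd0z.
exists g, (\col_i (u i ord0 %/ g%:Z)%Z); split => //; last first.
  by apply/colP => i; rewrite !mxE mulrC divzK.
rewrite /primitive; set h := \big[_/_]_(_ < _) _.
(* As h divides all the quotients u_i / g, the product g h divides every entry of u, hence their gcd
   g. *)
have : (g * h %| g)%N.
  apply/dvdn_biggcdP => i _.
  rewrite -(divzK (gP i)) abszM mulnC dvdn_mul //.
  by apply: (biggcdn_inf i); rewrite // mxE.
by rewrite -[X in (_ %| X)%N]muln1 dvdn_pmul2l // dvdn1 => /eqP.
Qed.

(** * Positivity of forms and Gram matrices *)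

Section RankOneForms.
Variables (R : realType) (n : nat).
Implicit Types (phi : {linear 'M[R]_n -> R^o}) (z w : 'cV[R]_n).

Lemma qformZ (a : int) (u : 'cV[int]_n) :
  qform R (a *: u) = a%:~R ^+ 2 *: qform R u.
Proof.
by rewrite /qform map_mxZ /= linearZ /= -scalemxAl -scalemxAr scalerA -expr2.
Qed.

(* Evaluate phi at the primitive vectors (m u_i) u + e_j and let m grow. *)
Lemma linear_form_qform_ge0 phi (c : R) : (1 < n)%N ->
  (forall u, primitive u -> c <= phi (qform R u)) ->
  forall u, 0 <= phi (qform R u).
Proof.
move=> n1 phi_ge u; have [->|/colN0P[i ui]] := eqVneq u 0.
  by rewrite /qform map_mx0 mul0mx linear0.
have [j ji] := ord_neq i n1.
set a := phi _; set x := (u i 0)%:~R : R.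
set e := map_mx intr (delta_mx j 0 : 'cV[int]_n) : 'cV[R]_n.
set b := phi (e *m (map_mx intr u)^T + map_mx intr u *m e^T).
set f := phi (e *m e^T).
have H (m : nat) : c <= f + (m%:R * x) * b + (m%:R * x) ^+ 2 * a.
  have := phi_ge _ (primitive_shift u m%:Z ji).
  rewrite /qform addrC map_mxD map_mxZ linear_form_rank1D /=.
  by rewrite rmorphM /= -pmulrn.
have x0 : x != 0 by rewrite intr_eq0.
rewrite leNgt; apply/negP => a0.
have xa : 0 < - (x ^+ 2 * a) by rewrite oppr_gt0 pmulr_rlt0 // exprn_even_gt0.
(* A is minus the coefficient of m^2. For M > B / A and M >= 1 the quadratic term outweighs the
   others, and the value drops below c. *)
set A := - _ in xa; set B := `|x * b| + `|f - c| + 1.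
have [m mP] : exists m : nat, B / A < m.+1%:R.
  exists (Num.bound (B / A)).
  rewrite (lt_le_trans (archi_boundP _)) ?ler_nat //.
  by rewrite divr_ge0 ?(ltW xa) // /B !addr_ge0 ?normr_ge0 ?ler01.
have := H m.+1; apply/negP; rewrite -ltNge.
move: mP; rewrite ltr_pdivrMr // => mP.
have m1 : 1 <= m.+1%:R :> R by rewrite ler1n.
have h1 := ler_norm (x * b); have h2 := ler_norm (f - c).
have h0 := normr_ge0 (f - c).
rewrite /B /A in mP; set M := m.+1%:R in mP m1 *.
have : M * (`|x * b| + `|f - c| + 1) < M * (M * - (x ^+ 2 * a)).
  by rewrite ltr_pM2l // (lt_le_trans ltr01).
have : M * (x * b) <= M * `|x * b| by rewrite ler_wpM2l // (le_trans ler01).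
have : `|f - c| <= M * `|f - c| by rewrite ler_peMl.
nra.
Qed.

Lemma linear_form_qform_ge phi (c : R) : 0 <= c ->
  (forall u, primitive u -> c <= phi (qform R u)) ->
  forall u, u != 0 -> c <= phi (qform R u).
Proof.
move=> c0 phi_ge u /primitive_part [g [u' [g0 /phi_ge pu' ->]]].
rewrite qformZ linearZ /= (le_trans pu') // ler_peMl ?(le_trans c0) //.
by rewrite expr_ge1 // ?ler1z // ?ler0z //; lia.
Qed.

Lemma ge0_quadratic_linear_coef (a b : R) :
  (forall s : R, 0 <= s * b + s ^+ 2 * a) -> b = 0.
Proof.
move=> H; have a0 : 0 <= a by have := H 1; have := H (-1); lra.
have a1 : a + 1 != 0 by rewrite gt_eqF // ltr_wpDl.
(* The value at this s is -(b / (a + 1))^2; the summand 1 covers the case a = 0. *)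
have := H (- b / (a + 1)).
rewrite (_ : _ + _ = - (b / (a + 1)) ^+ 2); last by field.
rewrite oppr_ge0 => b0; apply/eqP; move: (sqr_ge0 (b / (a + 1))) => b1.
have /eqP : (b / (a + 1)) ^+ 2 = 0 by apply/le_anti; rewrite b0 b1.
by rewrite sqrf_eq0 mulf_eq0 invr_eq0 (negPf a1) orbF.
Qed.

Lemma gram_mx_eq0 p (N : 'M[R]_(n, p)) : \tr (N^T *m N) = 0 -> N = 0.
Proof.
rewrite /mxtrace => /eqP; rewrite psumr_eq0 => [/allP H|i _]; last first.
  by rewrite mxE sumr_ge0 // => j _; rewrite mxE -expr2 sqr_ge0.
apply/matrixP => j i; rewrite mxE; have /= := H i (mem_index_enum _).
rewrite mxE psumr_eq0 => [/allP /(_ j (mem_index_enum _))|k _].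
  by rewrite /= mxE -expr2 sqrf_eq0 => /eqP.
by rewrite mxE -expr2 sqr_ge0.
Qed.

(** Moving N to N + (s / 2) N x gives a nonnegative quadratic polynomial in s without constant term.
    Its linear coefficient, the sum of the squares of the entries of N x, must vanish. *)
Lemma psd_gram_eq0 (x N : 'M[R]_n) : x^T = x ->
  (forall B : 'M[R]_n, 0 <= trace_form (B^T *m B) x) ->
  trace_form (N^T *m N) x = 0 -> N *m x = 0.
Proof.
move=> xs psd N0; apply: gram_mx_eq0; rewrite trmx_mul xs -mulmxA.
set B := N *m x.
apply: (@ge0_quadratic_linear_coef (trace_form (B^T *m B) x / 4)).
move=> s; have := psd (N + (s / 2) *: B).
have -> : trace_form ((N + (s / 2) *: B)^T *m (N + (s / 2) *: B)) x =
   trace_form (N^T *m N) x + s * \tr (x *m (N^T *m B))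
   + s ^+ 2 * (trace_form (B^T *m B) x / 4).
  rewrite /trace_form [(_ + _)^T]linearD /= [(_ *: _)^T]linearZ /=.
  rewrite !mulmxDl !mulmxDr -!scalemxAl -!scalemxAr !mulmxDl -!scalemxAl.
  rewrite !scalerA !linearD !linearZ /=.
  have -> : \tr (B^T *m N *m x) = \tr (x *m (N^T *m B)).
    by rewrite -mxtrace_tr !trmx_mul !trmxK xs.
  have -> : \tr (N^T *m B *m x) = \tr (x *m (N^T *m B)) by rewrite mxtrace_mulC.
  by rewrite /GRing.scale /=; field.
by rewrite N0 add0r.
Qed.

End RankOneForms.

(** * Minimal vectors: vertices, dimension and rounding *)

Section MinimalVectors.
Variables (R : realType) (n : nat).
Implicit Types (phi : {linear 'M[R]_n -> R^o}).

(** The form tr(P^T P x) is nonnegative on the polyhedron and vanishes there only if P x = 0, which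
    makes the symmetric x a multiple of [qform R w]; the equation phi x = c > 0 then fixes the
    multiple. *)
Lemma primitive_vertex phi (c : R) (w : 'cV[int]_n) : (1 < n)%N -> 0 < c ->
  (forall u, primitive u -> c <= phi (qform R u)) ->
  primitive w -> phi (qform R w) = c ->
  is_vertex (voronoi_polyhedron R n `&` [set x | phi x = c]) (qform R w).
Proof.
move=> n1 c0 phi_ge pw wc; have [i wi] := colN0P (primitive_neq0 pw).
have [j ji] := ord_neq i n1.
pose W := map_mx intr w : 'cV[R]_n.
have Wi : W i 0 != 0 by rewrite mxE intr_eq0.
(* P z = 0 iff z is proportional to w. *)
pose P : 'M[R]_n := (W i 0)%:M - W *m delta_mx 0 i.
have PE (B : 'M[R]_n) a b : (P *m B) a b = W i 0 * B a b - W a 0 * B i b.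
  by rewrite mulmxBl mul_scalar_mx -mulmxA -rowE !mxE big_ord1 !mxE.
have Pz (z : 'cV[R]_n) a : (P *m z) a 0 = W i 0 * z a 0 - W a 0 * z i 0.
  by rewrite mulmxBl mul_scalar_mx -mulmxA -rowE !mxE big_ord1 !mxE.
exists (trace_form (P^T *m P)), 0; split.
(* Since j differs from i, P e_j = W_i e_j is nonzero. *)
- pose e := delta_mx j 0 : 'cV[R]_n.
  exists (e *m e^T); first by rewrite trmx_mul trmxK.
  rewrite /= trace_form_gram psumr_neq0 => [|k _]; last exact: sqr_ge0.
  apply/hasP; exists j; rewrite ?mem_index_enum //= lt_neqAle sqr_ge0 andbT.
  have ij : (i == j) = false by rewrite eq_sym (negPf ji).
  rewrite eq_sym sqrf_eq0 Pz !mxE eqxx ij /= mulr1 mulr0 subr0.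
  by move: Wi; rewrite mxE.
- by move=> x [Px _]; exact: polyhedron_gram_ge0.
apply/seteqP; split => [_ ->|x [[Px /= xc] /= x0]] /=.
  split; first by split => //; exact: polyhedron_qform.
  rewrite /qform trace_form_gram big1 // => k _.
  by rewrite Pz mulrC subrr expr0n.
have xs := polyhedron_sym Px.
have Nx0 := psd_gram_eq0 xs (fun B => polyhedron_gram_ge0 B Px) x0.
have xE a b : W i 0 * x a b = W a 0 * x i b.
  by apply/eqP; rewrite -subr_eq0 -PE Nx0 mxE.
have xW : x = (x i i / W i 0 ^+ 2) *: qform R w.
  apply/matrixP => a b; rewrite /qform [RHS]mxE [X in _ * X]mxE big_ord1.
  rewrite [(map_mx _ _)^T _ _]mxE -/W.
  have := xE a b; rewrite -{1 2}xs [x^T i b]mxE => h1; have h2 := xE b i.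
  apply: (mulfI Wi); rewrite xs in h1; rewrite h1; apply: (mulfI Wi).
  by rewrite mulrCA h2; field.
have := xc; rewrite {1}xW linearZ /= wc => /eqP; rewrite -subr_eq0.
rewrite -[X in _ - X]mul1r -mulrBl mulf_eq0 (gt_eqF c0) orbF subr_eq0 => /eqP h.
by rewrite xW h scale1r.
Qed.

Lemma dim_symmetric_le (U : {vspace 'M[R]_n}) :
  (forall x, x \in U -> x^T = x) -> (\dim U <= (n * n.+1)./2)%N.
Proof.
move=> Us; pose A := [pred p : 'I_n * 'I_n | (p.2 <= p.1)%N].
(* The disjunction gives a diagonal pair the entry 1 instead of 2. *)
pose S (p : 'I_n * 'I_n) : 'M[R]_n :=
  \matrix_(a, b) ((a == p.1) && (b == p.2) || (a == p.2) && (b == p.1))%:R.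
have sAE : #|A| = (n * n.+1)./2.
  have -> : (n * n.+1)./2 = 'C(n.+1, 2) by rewrite bin2 mulnC.
  rewrite -bin2_sum big_nat_recl // add0n big_mkord -sum1_card.
  rewrite (eq_bigl (fun p : 'I_n * 'I_n => true && (p.2 <= p.1)%N)); last first.
    by move=> p; rewrite /A inE.
  rewrite -(pair_big_dep xpredT (fun i j : 'I_n => j <= i)%N (fun _ _ => 1%N)).
  apply: eq_bigr => i _; under eq_bigl do rewrite -ltnS.
  by rewrite (big_ord_narrow (ltn_ord i)) /= sum1_card card_ord.
rewrite -sAE cardE -(size_map S); apply: leq_trans (dim_span _).
apply/dimvS/subvP => x /Us xs.
have -> : x = \sum_(p in A) x p.1 p.2 *: S p.
  apply/matrixP => a b; rewrite summxE.
  pose p0 := if (b <= a)%N then (a, b) else (b, a).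
  have p0A : p0 \in A.
    by rewrite /p0; case: leqP => ab; rewrite inE /= ?ab ?(ltnW ab).
  rewrite (bigD1 p0) //= big1 ?addr0 => [|p /andP[pA pp0]]; rewrite !mxE.
    rewrite /p0; case: leqP => _ /=; rewrite ?eqxx ?orbT /= mulr1 //.
    by rewrite -{1}xs mxE.
  rewrite [X in (nat_of_bool X)%:R](_ : _ = false) ?mulr0 //.
  apply: contraNF pp0.
  move: pA; rewrite /A inE /p0; case: p => k l /= lk.
  case/orP=> /andP[/eqP ? /eqP ?]; subst; rewrite ?lk //.
  case: leqP => // kl; suff -> : k = l by rewrite eqxx.
  by apply/val_inj/eqP; rewrite /= eqn_leq kl lk.
apply: rpred_sum => p pA; rewrite rpredZ // memv_span // map_f //.
by rewrite mem_enum.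
Qed.

(** Let s_i be 1 with probability f_i and 0 otherwise. Then f_i - s_i has mean 0 and variance f_i (1
    - f_i), so one of the two choices does no worse than the mean. *)
Lemma rounding phi (V : 'I_n -> 'cV[R]_n) (f : 'I_n -> R) :
  (forall i, 0 <= f i <= 1) ->
  exists s : 'I_n -> bool,
    let z := \sum_i (f i - (s i)%:R) *: V i in
    phi (z *m z^T) <= \sum_i f i * (1 - f i) * phi (V i *m (V i)^T).
Proof.
move=> f01; elim: (index_enum _) (index_enum_uniq 'I_n) => [_|i r IH /=].
  by exists xpred0; rewrite /= !big_nil mul0mx linear0.
case/andP => ir /IH [s]; rewrite /=.
set z := \sum_(j <- r) _; set t := \sum_(j <- r) _ => zt.
pose sb (b : bool) j := if j == i then b else s j.
have sbE b : \sum_(j <- i :: r) (f j - (sb b j)%:R) *: V j =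
    z + (f i - b%:R) *: V i.
  rewrite big_cons /sb eqxx addrC; congr (_ + _); apply: eq_big_seq => j jr.
  by rewrite ifN //; apply: contraNneq ir => <-.
set X := phi (z *m (V i)^T + V i *m z^T); set q := phi (V i *m (V i)^T).
have /andP[f0 f1] := f01 i.
(* This is the value for s_i = 0 minus the value for s_i = 1. *)
have [h|h] := leP (X + (2 * f i - 1) * q) 0.
  exists (sb false); rewrite sbE big_cons -/t linear_form_rank1D -/X -/q subr0.
  have := mulr_ge0_le0 f0 h; move: zt; set u := phi (z *m _); clearbody u t q X.
  move=> zt fh; lra.
exists (sb true); rewrite sbE big_cons -/t linear_form_rank1D -/X -/q.
have f1' : 0 <= 1 - f i by rewrite subr_ge0.
have := mulr_ge0 f1' (ltW h).
move: zt; set u := phi (z *m _); clearbody u t q X.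
rewrite mulr1n; move=> zt fh; lra.
Qed.

Lemma mulmx_colE (T : comPzRingType) p m (A : 'M[T]_(p, m)) (a : 'cV[T]_m) :
  A *m a = \sum_i a i 0 *: col i A.
Proof.
apply/colP => k; rewrite mxE summxE; apply: eq_bigr => i _.
by rewrite !mxE mulrC.
Qed.

(* Modulo the lattice spanned by the columns of M, rounding turns a point of
   Z^n outside of that lattice into a nonzero one where the quadratic form is
   at most n c / 4 < c. *)
Lemma min_vectors_unimodular phi (c : R) (M : 'M[int]_n) : (n < 4)%N -> 0 < c ->
  (forall u : 'cV_n, u != 0 -> c <= phi (qform R u)) ->
  (forall i, phi (qform R (col i M)) <= c) ->
  \det M != 0 -> `|\det M| = 1.
Proof.
move=> n4 c0 phi_ge colc d0.
(* If the columns of M span Z^n, then M has an integral right inverse and its determinant is a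
   unit. *)
have [/choice[g gP]|] := pselect (forall u : 'cV_n, exists m, M *m m = u).
  pose N := \matrix_(i, j) g (delta_mx j 0) i 0.
  have MN : M *m N = 1%:M.
    apply/matrixP => a b; rewrite [RHS]mxE.
    have := congr1 (fun u : 'cV_n => u a 0) (gP (delta_mx b 0)).
    rewrite !mxE eqxx andbT => <-; apply: eq_bigr => j _.
    by rewrite mxE.
  have := congr1 (fun x => `|\det x|) MN; rewrite det_mulmx det1 normrM normr1.
  move: (\det M) (\det N) => a b.
  rewrite -!abszE => /eqP; rewrite -PoszM eqz_nat muln_eq1 => /andP[/eqP-> _].
  by [].
rewrite -existsNE => -[u uN].
have uM m : u - M *m m != 0.
  by rewrite subr_eq0; apply/eqP => uE; apply: uN; exists m.
pose M' := map_mx intr M : 'M[R]_n.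
have M'u : M' \in unitmx by rewrite unitmxE det_map_mx unitfE intr_eq0.
have [a Ma] : exists a, M' *m a = map_mx intr u.
  by exists (invmx M' *m map_mx intr u); rewrite mulKVmx.
pose f i := a i 0 - (Num.floor (a i 0))%:~R.
have f01 i : 0 <= f i <= 1.
  by rewrite subr_ge0 floor_le /= lerBlDr addrC ltW // -intrD1 floorD1_gt.
have [s] := rounding phi (fun i => col i M') f01.
set z := \sum_i _; move=> /= zle.
pose m := \col_i (Num.floor (a i 0) + (s i)%:R : int).
have zE : map_mx intr (u - M *m m) = z.
  rewrite map_mxB map_mxM -Ma -mulmxBr mulmx_colE.
  apply: eq_bigr => i _; congr (_ *: _); rewrite !mxE /f rmorphD /= opprD addrA.
  by rewrite rmorph_nat.
have := phi_ge _ (uM m); rewrite /qform zE => /le_trans/(_ zle).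
apply: contraTeq => _; rewrite -ltNge.
apply: (@le_lt_trans _ _ (\sum_(i < n) (c / 4))).
  apply: ler_sum => i _.
  have -> : col i M' = map_mx intr (col i M) by rewrite map_col.
  have := colc i; rewrite /qform; have /andP[] := f01 i.
  move: (f i) (phi _) => x q x0 x1 qc.
  have h1 : 0 <= x * (1 - x) * (c - q) by rewrite !mulr_ge0 ?subr_ge0.
  (* This is c / 4 - c x (1 - x). *)
  have h2 : 0 <= c * (x - 2^-1) ^+ 2 by rewrite mulr_ge0 ?sqr_ge0 ?ltW.
  lra.
rewrite sumr_const card_ord -mulr_natr.
have : n%:R <= 3 :> R by rewrite ler_nat.
nra.
Qed.

End MinimalVectors.

(** * The trace form in the basis and the candidates *)

Section CandidateMinimum.
Variables (R : realType) (n : nat) (v : 'I_n -> 'cV[int]_n).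
Hypothesis v_free : det_cols v != 0.

Let M : 'M[int]_n := \matrix_(i, j) v j i 0.
Let N' : 'M[R]_n := map_mx intr (\adj M).

(* (det v)^2 times the trace in the basis v, to stay within the integers *)
Let T : {linear 'M[R]_n -> R^o} := trace_form (N'^T *m N').

Let col_M i : col i M = v i.
Proof. by apply/colP => k; rewrite !mxE. Qed.

Let T_qform u : T (qform R u) = \sum_i ((\adj M *m u) i 0)%:~R ^+ 2.
Proof.
rewrite /T /= /qform trace_form_gram; apply: eq_bigr => i _.
by rewrite -map_mxM mxE.
Qed.

Let T_bform : T (bform R v) = n%:R * (det_cols v)%:~R ^+ 2.
Proof.
rewrite /bform linear_sum (eq_bigr (fun=> (det_cols v)%:~R ^+ 2)).
  by rewrite sumr_const card_ord mulr_natl.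
move=> i _; rewrite T_qform -col_M colE mulmxA mul_adj_mx -colE (bigD1 i) //=.
rewrite !mxE eqxx big1 ?addr0 => [|k /negPf ki]; last by rewrite !mxE ki expr0n.
by [].
Qed.


Let adj_coord_lt (u : 'cV[int]_n) i :
  T (qform R u) < (det_cols v)%:~R ^+ 2 -> `|(\adj M *m u) i 0| < `|det_cols v|.
Proof.
rewrite T_qform => uT; rewrite -(ltr_pXn2r (_ : 0 < 2)%N) ?nnegrE //.
rewrite !real_normK ?num_real // -(ltr_int R) !rmorphXn; apply: le_lt_trans uT.
by rewrite (bigD1 i) //= lerDl sumr_ge0 // => j _; exact: sqr_ge0.
Qed.

Let mul_adj (u : 'cV[int]_n) : M *m (\adj M *m u) = det_cols v *: u.
Proof. by rewrite mulmxA mul_mx_adj mul_scalar_mx. Qed.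

(** By Cramer's rule, the coordinates of u in the basis v are the entries of [\adj M *m u] divided
    by the determinant. *)
Let Cand_adj_lt (u : 'cV[int]_n) : u != 0 ->
  T (qform R u) < (det_cols v)%:~R ^+ 2 -> Cand v u.
Proof.
move=> u0 /adj_coord_lt kd; split => //.
move: (mul_adj u) kd; set k := \adj M *m u; set d := det_cols v => Mk kd.
have d0 : d%:~R != 0 :> rat by rewrite intr_eq0 v_free.
exists (fun i => (k i 0)%:~R / d%:~R); split => [i|].
  rewrite normr_ge0 normf_div ltr_pdivrMr ?normr_gt0 // mul1r.
  by rewrite -!intr_norm ltr_int kd.
apply/colP => j; rewrite mxE summxE.
have := congr1 (fun x : 'cV_n => x j 0) Mk; rewrite /= !mxE => Mkj.
apply: (mulfI d0); rewrite -rmorphM -Mkj rmorph_sum mulr_sumr.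
by apply: eq_bigr => i _; rewrite !mxE rmorphM /=; field.
Qed.

(* A vector u with T (qform u) < (det v)^2 is determined by the integral vector
   adj M * u, whose entries are less than |det v|; K is a sum over these. *)
Let adj_threshold (phi : {linear 'M[R]_n -> R^o}) (c : R) :
  exists2 K : R, 0 <= K & forall u : 'cV[int]_n, c < phi (qform R u) ->
    T (qform R u) < (det_cols v)%:~R ^+ 2 ->
    (det_cols v)%:~R ^+ 2 <= K * (phi (qform R u) - c).
Proof.
set d := det_cols v; pose D := `|d|%N.
(* The shift by D encodes the integers from -D to D - 1, among them all those of absolute value less
   than D. *)
pose dec (e : {ffun 'I_n -> 'I_(D + D)}) : 'cV[int]_n :=
  \col_i ((e i)%:Z - D%:Z).
(* If e encodes [\adj M *m u], then [M *m dec e] is d u, so that [g e] is the excess of phi at u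
   over c. *)
pose g e := phi (qform R (M *m dec e)) / d%:~R ^+ 2 - c.
(* The absolute value keeps all terms nonnegative; where [g e] is 0, the quotient is 0 by
   convention. *)
pose K := \sum_e (d%:~R ^+ 2 / `|g e|).
have Kge0 e : 0 <= d%:~R ^+ 2 / `|g e| by rewrite divr_ge0 ?sqr_ge0.
exists K; first exact: sumr_ge0.
move=> u cu /adj_coord_lt; rewrite -/d => kd.
have kD i : (`|((\adj M *m u) i 0 + D%:Z)%R| < D + D)%N by have := kd i; lia.
pose e := [ffun i => Ordinal (kD i)].
have de : dec e = \adj M *m u.
  apply/colP => i; rewrite mxE ffunE /=; move: (kd i).
  move: ((\adj M *m u) i 0) => x kx; lia.
have d2 : d%:~R ^+ 2 != 0 :> R by rewrite expf_eq0 /= intr_eq0 v_free.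
have ge : g e = phi (qform R u) - c.
  rewrite /g de mul_adj -/d qformZ linearZ /= /GRing.scale /=.
  by rewrite mulrAC divff // mul1r.
rewrite -ge; have g0 : 0 < g e by rewrite ge subr_gt0.
rewrite -ler_pdivrMr // -[X in _ / X](gtr0_norm g0) /K (bigD1 e) //= lerDl.
by apply: sumr_ge0.
Qed.

Lemma bform_neq0 : (0 < n)%N -> bform R v != 0.
Proof.
move=> n0; apply/eqP => b0; have /eqP := T_bform; rewrite b0 linear0 eq_sym.
rewrite mulf_eq0 pnatr_eq0 -leqn0 leqNgt n0 /= expf_eq0 /= intr_eq0.
by rewrite (negPf v_free).
Qed.

Lemma min_vector_in_Cand (phi : {linear 'M[R]_n -> R^o}) (c t : R)
    (y : 'M[R]_n) :
  (n < 4)%N -> 0 < c -> 1 < `|det_cols v| -> (forall i, primitive (v i)) ->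
  (forall u, primitive u -> c <= phi (qform R u)) ->
  voronoi_polyhedron R n y -> phi y = c -> 0 <= t -> bform R v = t *: y ->
  exists w, [/\ primitive w, Cand v w & phi (qform R w) = c].
Proof.
move=> n4 c0 d1 pv phi_ge Py yc t0 bty.
apply: contrapT => no_w; set d := det_cols v in d1 *.
have d2 : 0 < d%:~R ^+ 2 :> R by rewrite exprn_even_gt0 //= intr_eq0 v_free.
have [K K0 KP] := adj_threshold phi c.
have Ty : d%:~R ^+ 2 <= T y.
  pose psi : {linear 'M[R]_n -> R^o} := T \+ K \*: phi.
  have psiE x : psi x = T x + K * phi x by [].
  have := @linear_form_ge_polyhedron R n psi (d%:~R ^+ 2 + K * c) _ _ Py.
  rewrite !psiE yc lerD2r; apply => u pu; rewrite psiE.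
  have h0 : 0 <= T (qform R u).
    by rewrite T_qform; apply: sumr_ge0 => i _; rewrite sqr_ge0.
  have [h|h] := leP (d%:~R ^+ 2) (T (qform R u)).
    have := mulr_ge0 K0 (_ : 0 <= phi (qform R u) - c).
    rewrite subr_ge0 => /(_ (phi_ge _ pu)).
    move: h; lra.
  (* Here u is a candidate, so by [no_w] it cannot lie on the hyperplane, and the choice of K
     applies. *)
  have uc : c < phi (qform R u).
    rewrite lt_neqAle phi_ge // andbT; apply/eqP => uc; apply: no_w.
    by exists u; split => //; apply: Cand_adj_lt => //; exact: primitive_neq0.
  have := KP _ uc h; lra.
have tn : t <= n%:R.
  have := T_bform; rewrite bty linearZ /= => tT.
  by rewrite -(ler_pM2r d2) -/d -tT ler_wpM2l.
have phib : \sum_i phi (qform R (v i)) = t * c.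
  by rewrite -linear_sum -/(bform R v) bty linearZ /= yc.
(* The n values are each at least c and add up to at most n c. *)
have vc i : phi (qform R (v i)) <= c.
  have : \sum_i phi (qform R (v i)) <= \sum_(i < n) c.
    by rewrite phib sumr_const card_ord -mulr_natl ler_wpM2r // ltW.
  rewrite (bigD1 i) //= [leRHS](bigD1 i) //=.
  have : \sum_(j < n | j != i) c <= \sum_(j | j != i) phi (qform R (v j)).
    by apply: ler_sum => j _; exact/phi_ge/pv.
  lra.
have := @min_vectors_unimodular R n phi c M n4 c0
  (linear_form_qform_ge (ltW c0) phi_ge).
rewrite -/(det_cols v) => /(_ _ v_free) det1.
by move: d1; rewrite det1 // => i; rewrite col_M.
Qed.

End CandidateMinimum.

(** * Level of a top-dimensional face and conclusion *)

(** For c = 0 the cone would lie in the symmetric part of the kernel of phi, a proper subspace of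
    the symmetric matrices because of x0, hence of too small a dimension. *)
Lemma top_dimensional_face_level (R : realType) n
    (phi : {linear 'M[R]_n -> R^o}) (c : R) (x0 : 'M[R]_n) :
  x0^T = x0 -> phi x0 != 0 ->
  top_dimensional
    (cone_over (voronoi_polyhedron R n `&` [set x | phi x = c])) ->
  c != 0.
Proof.
move=> xs x0phi [U [_ Umin dimU]]; apply/eqP => c0.
pose tr : {linear 'M[R]_n -> 'M[R]_n} := trmx \- idfun.
pose Sym := lker (linfun tr).
have SymP x : (x \in Sym) = (x^T == x).
  by rewrite memv_ker lfunE /= subr_eq0.
pose W := (Sym :&: lker (linfun phi))%VS.
have UW : (U <= W)%VS.
  apply: Umin => x [->|[t [y [_ [Py /= yc] ->]]]]; first exact: mem0v.
  rewrite memv_cap SymP [_^T]linearZ /= polyhedron_sym // eqxx.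
  by rewrite memv_ker lfunE /= linearZ /= yc c0 scaler0.
have Sdim : (\dim Sym <= \dim W)%N.
  rewrite (leq_trans _ (dimvS UW)) // dimU dim_symmetric_le // => x.
  by rewrite SymP => /eqP.
have /eqP WS : W == Sym by rewrite eqEdim capvSl Sdim.
have : x0 \in W by rewrite WS SymP xs.
by rewrite memv_cap => /andP[_]; rewrite memv_ker lfunE /= (negPf x0phi).
Qed.

Theorem theorem3p12 (R : realType) (n : nat) (hn : n = 2%N \/ n = 3%N)
    (v : 'I_n -> 'cV[int]_n) (hv : forall i, primitive (v i))
    (hdet : 1 < `|det_cols v|)
    (sigma : set 'M[R]_n) (hsigma : voronoi_fan R n sigma)
    (htop : top_dimensional sigma) (hb : sigma (bform R v)) :
  (Cand v `&` Vertex sigma) !=set0.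
Proof.
have [n1 n4] : (1 < n)%N /\ (n < 4)%N by lia.
have v_free : det_cols v != 0 by rewrite -normr_gt0 (lt_trans ltr01).
case: hsigma => F [phi [c [[x0 x0s x0phi] Pphi FE]]] sigmaE; subst F sigma.
have c_neq0 := top_dimensional_face_level x0s x0phi htop.
have phi_ge u : primitive u -> c <= phi (qform R u).
  by move=> /polyhedron_qform /Pphi.
have [t [y [t0 [Py /= yc] bty]]] : exists t y, [/\ 0 <= t,
    (voronoi_polyhedron R n `&` [set x | phi x = c]) y & bform R v = t *: y].
  (* The point 0 added to every cone is excluded, as b(v) is nonzero. *)
  by case: hb => //= b0; have := bform_neq0 R v_free (ltnW n1); rewrite b0 eqxx.
have c0 : 0 < c.
  rewrite lt_neqAle eq_sym c_neq0 -yc.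
  apply: linear_form_ge_polyhedron Py => u _.
  exact: linear_form_qform_ge0 phi_ge u.
have [w [pw wC wc]] :=
  min_vector_in_Cand v_free n4 c0 hdet hv phi_ge Py yc t0 bty.
exists w; split => //; split => //.
exists (voronoi_polyhedron R n `&` [set x | phi x = c]); split => //.
  by exists phi, c; split => //; exists x0.
exact: primitive_vertex.
Qed.
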